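(* Let $p>3$ be a prime. Let $a,b,c$ be integers and let $d=b^2-4c$. If $p\nmid a$, then $$\sum_{k=0}^{p-1}\binom{2k}{k}\frac{T_{2k}(b+a,c)}{a^{2k}4^k}\equiv\left(\frac{2a}{p}\right)\left(\sqrt{c}\right)^{\frac{p-1}{2}}P_{\frac{p-1}{2}}\left(\frac{2ab+d}{4a\sqrt{c}}\right)\pmod p.$$
   Context: For integers $b,c$ and $n\ge0$, the generalized central trinomial coefficient $T_n(b,c)$ is the coefficient of $x^n$ in $(x^2+bx+c)^n$, i.e. $T_n(b,c)=\sum_{j=0}^{\lfloor n/2\rfloor}\binom{n}{2j}\binom{2j}{j}b^{n-2j}c^j$. The Legendre polynomial is $P_n(x)=\sum_{k=0}^n\binom{n}{k}\binom{n+k}{k}\left(\frac{x-1}{2}\right)^k$. The symbol $\left(\frac{\cdot}{p}\right)$ is the Legendre symbol. Since $P_n(-x)=(-1)^nP_n(x)$, the expression $(\sqrt c)^nP_n(y/\sqrt c)$ is a polynomial in $y$ and $c$ with coefficients in $\mathbb{Z}[1/2]$, independent of the choice of the square root $\sqrt c$; for $c=0$ it is understood as the value of this polynomial. The congruence modulo $p$ is between rational numbers whose denominators are prime to $p$. *)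

(* Defs.v *)
From mathcomp Require Import all_boot all_order all_algebra.
Set Implicit Arguments.
Unset Strict Implicit.
Unset Printing Implicit Defensive.
Import Order.TTheory GRing.Theory Num.Theory.
Local Open Scope ring_scope.

Definition central_trinomial (n : nat) (b c : int) : int :=
  (('X^2 + b%:P * 'X + c%:P) ^+ n)`_n.

Definition legendre_symbol (a : int) (p : nat) : int :=
  if (p %| a)%Z then 0
  else if [exists x : 'I_p, ((x%:Z ^+ 2 == a %[mod p])%Z)] then 1
  else -1.

Definition rat_eqmod (p : nat) (x y : rat) : Prop :=
  [/\ coprimez p (denq x), coprimez p (denq y) & (p %| numq (x - y))%Z].

Definition legendre_poly (n : nat) : {poly rat} :=
  \sum_(k < n.+1) ('C(n, k) * 'C(n + k, k))%:R *: (2^-1 *: ('X - 1)) ^+ k.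

(* The value at (y, c) of the polynomial (sqrt c)^n P_n(y / sqrt c).  Expanding
   it gives the terms [x^i]P_n * y^i * (sqrt c)^(n - i); since P_n has the
   parity of n, only even n - i contribute, and no square root is left.
   See sqrt_legendreE for the case c != 0. *)
Definition sqrt_legendre (n : nat) (y c : rat) : rat :=
  \sum_(i < n.+1) (legendre_poly n)`_i * y ^+ i * c ^+ (n - i)./2.

Lemma size_legendre_poly n : (size (legendre_poly n) <= n.+1)%N.
Proof.
apply: (leq_trans (size_sum _ _ _)); apply/bigmax_leqP => k _.
apply: (leq_trans (size_scale_leq _ _)); rewrite exprZn.
apply: (leq_trans (size_scale_leq _ _)).
by rewrite -[1]/(1%:P) size_exp_XsubC ltn_ord.
Qed.

(* Rodrigues' formula, in the variable (x - 1) / 2. *)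
Lemma legendre_poly_rodrigues n :
  legendre_poly n =
    ('X^n * (1 + 'X) ^+ n)^`N(n) \Po (2^-1 *: ('X - 1)).
Proof.
have -> : 'X^n * (1 + 'X) ^+ n = \sum_(k < n.+1) 'X^(n + k) *+ 'C(n, k) :> {poly rat}.
  rewrite exprDn mulr_sumr; apply: eq_bigr => k _.
  by rewrite expr1n mul1r mulrnAr -exprD.
rewrite raddf_sum linear_sum; apply: eq_bigr => k _.
rewrite raddfMn /= nderivnXn [(n + k - n)%N]addKn -mulrnA raddfMn /= comp_Xn_poly.
rewrite -scaler_nat mulnC; congr (_ %:R *: _); congr muln.
by rewrite -[RHS]bin_sub ?leq_addr // addKn.
Qed.

Lemma derivn_comp_opp n (p : {poly rat}) :
  (p \Po (-1 - 'X))^`(n) = (-1) ^+ n *: (p^`(n) \Po (-1 - 'X)).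
Proof.
elim: n => [|n IHn]; first by rewrite scale1r.
rewrite !derivnS IHn derivZ deriv_comp; move: (p^`(n)) => q.
have -> : (-1 - 'X)^`() = -1 :> {poly rat}.
  by rewrite derivB derivX -[1 in X in (X - _)]polyC1 derivN derivC oppr0 sub0r.
by rewrite mulrN1 exprS mulN1r scaleNr scalerN.
Qed.

Lemma legendre_poly_opp n :
  legendre_poly n \Po (- 'X) = (-1) ^+ n *: legendre_poly n.
Proof.
rewrite legendre_poly_rodrigues; set G := 'X^n * _.
have GE : G \Po (-1 - 'X) = G.
  rewrite /G rmorphM /= !rmorphXn /= raddfD /= comp_polyX -polyC1 comp_polyC polyC1.
  rewrite addrA subrr sub0r -opprD -!exprMn.
  by rewrite mulrNN mulrC.
have RE : G^`N(n) \Po (-1 - 'X) = (-1) ^+ n *: G^`N(n).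
  have := derivn_comp_opp n G; rewrite GE nderivn_def raddfMn /= => H.
  have nf : (n`!)%:R != 0 :> rat by rewrite pnatr_eq0 -lt0n fact_gt0.
  apply: (scalerI nf); rewrite scaler_nat scalerA mulrC -scalerA scaler_nat H.
  by rewrite scalerA -expr2 sqrr_sign scale1r.
rewrite -comp_polyA -comp_polyZ -RE -comp_polyA; congr (_ \Po _).
rewrite !comp_polyZ !raddfB /= !comp_polyX -polyC1 raddfN /= !comp_polyC.
rewrite -[in RHS]polyCN comp_polyC; apply/polyP => i.
rewrite !(coefZ, coefB, coefN, coefC, coefX).
by case: i => [|[|i]] /=; rewrite ?(mulr0, mulr1, subr0, sub0r, oppr0, opprK, addr0); apply/eqP.
Qed.

Lemma legendre_poly_parity n i :
  odd (n + i) -> (legendre_poly n)`_i = 0.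
Proof.
move=> ni; have := congr1 (fun q : {poly rat} => q`_i) (legendre_poly_opp n).
have -> : legendre_poly n \Po (- 'X) = \poly_(j < n.+1) ((-1) ^+ j * (legendre_poly n)`_j).
  rewrite poly_def [legendre_poly n in LHS](_ : _ = \poly_(j < n.+1) (legendre_poly n)`_j); last first.
    apply/polyP => j; rewrite coef_poly; case: ltnP => // hj.
    by rewrite nth_default // (leq_trans (size_legendre_poly n)).
  rewrite poly_def linear_sum; apply: eq_bigr => j _ /=.
  rewrite comp_polyZ comp_Xn_poly [(- 'X) ^+ j]exprNn -signr_odd -[in RHS]signr_odd mulrC -scalerA.
  by case: (odd j); rewrite ?(expr0, expr1, mulrN1, mulr1, scaleN1r, scale1r, scalerN).
rewrite coef_poly coefZ; case: ltnP => hi; last first.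
  by move=> _; rewrite nth_default // (leq_trans (size_legendre_poly n)).
have -> : (-1) ^+ n = - (-1) ^+ i :> rat.
  rewrite -signr_odd -[in RHS]signr_odd; move: ni; rewrite oddD.
  by case: (odd n); case: (odd i) => //=; rewrite !(expr0, expr1, opprK).
rewrite mulNr => /eqP; rewrite -addr_eq0 -mulr2n mulrn_eq0 /=.
by rewrite mulf_eq0 signr_eq0 /= => /eqP.
Qed.

Lemma sqrt_legendreE (F : numFieldType) (n : nat) (y c : rat) (s : F) :
  s != 0 -> s ^+ 2 = ratr c ->
  ratr (sqrt_legendre n y c) =
    s ^+ n * (map_poly ratr (legendre_poly n)).[ratr y / s].
Proof.
move=> s0 sc.
rewrite (@horner_coef_wide _ n.+1); last first.
  by rewrite size_map_poly size_legendre_poly.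
rewrite mulr_sumr rmorph_sum; apply: eq_bigr => i _ /=.
rewrite coef_map /= !rmorphM /= !rmorphXn /= -sc -exprM.
case: (boolP (odd (n + i))) => ni.
  by rewrite legendre_poly_parity // rmorph0 !(mul0r, mulr0).
have hi : (i <= n)%N by rewrite -ltnS.
have -> : (2 * (n - i)./2)%N = (n - i)%N.
  by rewrite mul2n halfK oddB // -oddD (negbTE ni) subn0.
move: (ratr y) => z; rewrite expr_div_n -[in s ^+ n](subnK hi) exprD.
rewrite [ratr _ * (_ / _)]mulrA mulrACA mulfV ?expf_neq0 // mulr1.
by rewrite [RHS]mulrC.
Qed.

(* Main.v *)
Require Import Defs.
From mathcomp Require Import all_boot all_order all_algebra.
From mathcomp Require Import all_field ring.
Import Order.TTheory GRing.Theory Num.Theory.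
Local Open Scope ring_scope.
Set Implicit Arguments.
Unset Strict Implicit.
Unset Printing Implicit Defensive.

(** Write p = 2n + 1.  In 'F_p the n-th power is the quadratic character, so
    that the coefficient of X^(p-1) in f^n counts, up to sign and a correction
    from the top degree, the affine points of the curve y^2 = f(x)
    (sum_horner).  Both sides of the congruence are such coefficients, and the
    theorem compares the point counts of a quartic and of a cubic.

    Left side.  Since 'C(2k, k) = 'C(n, k) (-4)^k in 'F_p
    (bin_central_mod), and T_(2k)(b + a, c) is the coefficient of X^(2k) in
    R^(2k) for R = X^2 + (b + a) X + c, the sum is the coefficient of X^(2n) in
    (a^2 X^2 - R^2)^n.  Here R^2 - a^2 X^2 = Q Q' with Q = X^2 + b X + c and
    Q' = X^2 + (2a + b) X + c (sum_bin_trinomial_coef).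

    Quartic to cubic.  Put u = x + c/x.  Then
    Q(x) Q'(x) = x^2 (u + b) (u + 2a + b), and u has 1 + (u^2 - 4c)^n preimages
    x (sum_quad_root).  So the character sum of Q Q' reduces to the ones of
    (u + b) (u + 2a + b), which is -1, and of
    (u^2 - 4c) (u + b) (u + 2a + b).  The last quartic has the rational root
    u = -b; sending it to infinity by u = -b + 1/v, and then taking
    v = (w - 1) / (2a), turns it into the cubic w (d w^2 + e w + d') with
    e = -(4ab + 2d) and d' = 4a^2 + 4ab + d, up to a square factor.  Its
    coefficient is the one of X^n in (d X^2 + e X + d')^n, which is the central
    trinomial coefficient of (e, d d') (coef_quartic_exp).

    Right side.  Over the rationals, the Legendre polynomial is itself a central
    trinomial coefficient:
    (sqrt c)^n P_n(y / sqrt c) = T_n(y, (y^2 - c) / 4)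
    (sqrt_legendre_trinomial_coef).  At y = (2ab + d) / (4a) one has e = -8a y
    and d d' = (8a)^2 (y^2 - c) / 4, so the cubic gives (-8a)^n times this
    value, and (8a)^n = (2a)^n is the Legendre symbol by Euler's criterion.

    The relation reduces transports the result from 'F_p to rational numbers
    with denominator prime to p. *)

(** * Power sums over a finite field *)

Lemma expf_card_pred (F : finFieldType) (x : F) : x != 0 -> x ^+ #|F|.-1 = 1.
Proof.
move=> x0; apply: (mulIf x0); rewrite mul1r -exprSr prednK ?expf_card //.
exact: ltnW (finNzRing_gt1 F).
Qed.

Lemma sum_scale (F : finFieldType) (R : nmodType) (f : F -> R) (a b : F) :
  a != 0 -> \sum_x f (a * x + b) = \sum_x f x.
Proof.
move=> a0; rewrite [RHS](reindex (fun x => a * x + b)) //.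
apply: onW_bij; exists (fun x => (x - b) / a) => x; first by rewrite addrK mulrC mulKf.
by rewrite mulrC divfK // subrK.
Qed.

Lemma card_natr_eq0 (F : finFieldType) : #|F|%:R = 0 :> F.
Proof.
have := sum_scale (fun x : F => x) 1 (oner_neq0 F).
under eq_bigr do rewrite mul1r.
by rewrite big_split /= sumr_const => /(canRL (addKr _)); rewrite addNr.
Qed.

(** If q - 1 does not divide m, some x has x^m != 1, and the sum is invariant
    under multiplication by x^m. *)
Lemma sum_expr (F : finFieldType) (m : nat) : (0 < m)%N ->
  \sum_(x : F) x ^+ m = - (#|F|.-1 %| m)%N%:R.
Proof.
set q := #|F|.-1 => m0.
have qE : #|F| = q.+1 by rewrite /q prednK // ltnW // finNzRing_gt1.
case: (boolP (q %| m)%N) => [/dvdnP[k mE] | ndvd]; last first.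
  rewrite oppr0.
  have [x xP] : exists x : F, (x != 0) && (x ^+ m != 1).
    apply/existsP/contraT; rewrite negb_exists => /forallP H.
    have r0 : (0 < m %% q)%N by rewrite lt0n.
    have rq : (m %% q < q)%N by rewrite ltn_mod -ltnS -qE finNzRing_gt1.
    have := max_unity_roots (rs := enum (predC1 (0 : F))) r0 _ (enum_uniq _).
    rewrite -cardE cardC1 -/q leqNgt rq; apply.
    apply/allP => x; rewrite mem_enum inE /= => x0; apply/unity_rootP.
    have := H x; rewrite x0 /= negbK => /eqP; rewrite {1}(divn_eq m q) exprD mulnC.
    by rewrite exprM expf_card_pred // expr1n mul1r.
  have /andP[x0 xm] := xP; have := sum_scale (fun y => y ^+ m) 0 x0.
  set S := \sum_y y ^+ m.
  rewrite (eq_bigr (fun y => x ^+ m * y ^+ m)) => [|y _]; last by rewrite addr0 exprMn.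
  rewrite -mulr_sumr -/S => /eqP; rewrite -subr_eq0 -{2}[S]mul1r -mulrBl mulf_eq0.
  by rewrite subr_eq0 (negbTE xm) => /eqP.
rewrite (bigD1 0) //= expr0n gtn_eqF // add0r.
rewrite (eq_bigr (fun=> 1)) => [|x x0]; last first.
    by rewrite mE mulnC exprM expf_card_pred // expr1n.
rewrite sumr_const (cardC1 (0 : F)) -/q; apply/eqP.
rewrite -addr_eq0 natr1 -qE.
by rewrite card_natr_eq0.
Qed.

(** Up to degree 2(q - 1), only the monomials of degree q - 1 and 2(q - 1) have
    nonzero power sums; the constant one vanishes because q = 0 in F. *)
Lemma sum_horner (F : finFieldType) (f : {poly F}) :
  (size f <= (#|F|.-1).*2.+1)%N ->
  \sum_x f.[x] = - (f`_(#|F|.-1) + f`_(#|F|.-1).*2).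
Proof.
set q := #|F|.-1.
have q0 : (0 < q)%N by rewrite -ltnS /q prednK ?finNzRing_gt1 // ltnW // finNzRing_gt1.
move=> sf; under eq_bigr => x _ do rewrite (horner_coef_wide _ sf).
rewrite exchange_big /=; under eq_bigr => i _ do rewrite -mulr_sumr.
have i1 : (q < q.*2.+1)%N by rewrite ltnS -addnn leq_addl.
rewrite (bigD1 (Ordinal i1)) //= (bigD1 ord_max) /=; last first.
  by rewrite -val_eqE /= gtn_eqF // -addnn -{1}[q]addn0 ltn_add2l.
rewrite !sum_expr ?double_gt0 // -/q dvdnn (_ : q %| q.*2)%N -?muln2 ?dvdn_mulr // big1 => [|i /andP[]].
  by rewrite addr0 mulrN1 mulrN1 opprD.
rewrite -!val_eqE /= => iq i2.
have [->|i0] := posnP i; last first.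
  rewrite sum_expr // -/q; case: dvdnP => [[k ik]|]; last by rewrite oppr0 mulr0.
  have : (k * q < 3 * q)%N.
    by rewrite -ik; apply: leq_trans (ltn_ord i) _; rewrite -muln2 mulnC -addn1 [(3 * q)%N]mulSn addnC leq_add2r.
  rewrite ltn_pmul2r //; move: i0 iq i2; rewrite ik.
  by case: k {ik} => [|[|[|]]] //=; rewrite ?mul1n ?eqxx ?mul2n ?eqxx.
under eq_bigr do rewrite expr0.
by rewrite sumr_const card_natr_eq0 mulr0.
Qed.

(** * Central trinomial coefficients *)

Lemma coef_binomial (R : comNzRingType) (al ga : R) (k j : nat) : (j <= k)%N ->
  ((al *: 'X + ga%:P) ^+ k)`_j = al ^+ j * ga ^+ (k - j) *+ 'C(k, j).
Proof.
move=> jk; rewrite addrC exprDn coef_sum.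
rewrite (bigD1 (Ordinal (leq_ltn_trans jk (ltnSn k)))) //= big1 ?addr0 => [|i].
  by rewrite coefMn -rmorphXn coefCM exprZn coefZ coefXn eqxx mulr1 mulrC.
rewrite -val_eqE /= => ij.
by rewrite coefMn -rmorphXn coefCM exprZn coefZ coefXn eq_sym (negbTE ij) !mulr0 mul0rn.
Qed.

(** The coefficient depends on al and ga only through al * ga: in the expansion
    of (be X + (al X^2 + ga))^n, a term contributes to X^n only if X^2 and the
    constant are picked equally often. *)
Lemma coef_trinomial (R : comNzRingType) (al be ga : R) (n : nat) :
  ((al *: 'X^2 + be%:P * 'X + ga%:P) ^+ n)`_n =
  \sum_(k < n.+1 | ~~ odd k)
     be ^+ (n - k) * (al * ga) ^+ k./2 *+ ('C(k, k./2) * 'C(n, k)).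
Proof.
have -> : al *: 'X^2 + be%:P * 'X + ga%:P
  = be%:P * 'X + ((al *: 'X + ga%:P) \Po 'X^2).
  by rewrite comp_polyD comp_polyZ comp_polyX comp_polyC addrAC addrC addrA.
rewrite exprDn coef_sum [RHS]big_mkcond /=; apply: eq_bigr => k _.
have kn : (k <= n)%N by rewrite -ltnS.
rewrite coefMn exprMn -rmorphXn -mulrA coefCM coefXnM ltnNge leq_subr /= subKn //.
rewrite -rmorphXn /= coef_comp_poly_Xn // dvdn2; case: ifP => k2; last by rewrite mulr0 mul0rn.
have hk : (k - k./2 = k./2)%N by rewrite -{1}(odd_double_half k) (negbTE k2) add0n -addnn addnK.
rewrite divn2 coef_binomial; last by rewrite -divn2 leq_div.
by rewrite hk -exprMn mulrnAr -mulrnA.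
Qed.

Definition trinomial_coef (R : comNzRingType) (n : nat) (b c : R) : R :=
  (('X^2 + b%:P * 'X + c%:P) ^+ n)`_n.

Lemma trinomial_coefE (R : comNzRingType) (n : nat) (b c : R) : trinomial_coef n b c =
  \sum_(k < n.+1 | ~~ odd k) b ^+ (n - k) * c ^+ k./2 *+ ('C(k, k./2) * 'C(n, k)).
Proof. by rewrite /trinomial_coef -['X^2]scale1r coef_trinomial; under eq_bigr do rewrite mul1r. Qed.

Lemma trinomial_coef_lead (R : comNzRingType) (al be ga : R) (n : nat) :
  ((al *: 'X^2 + be%:P * 'X + ga%:P) ^+ n)`_n = trinomial_coef n be (al * ga).
Proof. by rewrite coef_trinomial trinomial_coefE. Qed.

Lemma trinomial_coefZ (R : comNzRingType) (n : nat) (s b c : R) :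
  trinomial_coef n (s * b) (s ^+ 2 * c) = s ^+ n * trinomial_coef n b c.
Proof.
rewrite !trinomial_coefE mulr_sumr; apply: eq_bigr => k ek.
have kn : (k <= n)%N by rewrite -ltnS.
rewrite exprMn [(s ^+ 2 * c) ^+ _]exprMn -exprM mul2n.
have -> : (k./2.*2 = k)%N by rewrite -[RHS]odd_double_half (negbTE ek).
by rewrite mulrACA -exprD subnK // mulrnAr.
Qed.

Lemma trinomial_coef_double0 (R : comNzRingType) (m : nat) (c : R) :
  trinomial_coef m.*2 0 c = c ^+ m *+ 'C(m.*2, m).
Proof.
rewrite trinomial_coefE (bigD1 ord_max) /= ?odd_double // subnn expr0 mul1r.
rewrite doubleK binn muln1 big1 ?addr0 // => k /andP[_ kn].
rewrite expr0n subn_eq0 leqNgt ltn_neqAle -ltnS ltn_ord andbT.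
by rewrite -val_eqE /= in kn; rewrite kn mul0r mul0rn.
Qed.

Lemma rmorph_trinomial_coef (R S : comNzRingType) (f : {rmorphism R -> S}) n b c :
  f (trinomial_coef n b c) = trinomial_coef n (f b) (f c).
Proof.
rewrite !trinomial_coefE rmorph_sum; apply: eq_bigr => k _.
by rewrite rmorphMn /= rmorphM !rmorphXn.
Qed.

(** * Central binomial coefficients modulo p *)

Lemma bin_central_rec k :
  (k.+1 * 'C(k.+1.*2, k.+1) = 2 * (k.*2.+1 * 'C(k.*2, k)))%N.
Proof.
rewrite -mul_bin_diag doubleS /= (mul_bin_down k.*2.+1 k).
by rewrite -addnn -addnS addKn -addSn addnn -mul2n mulnA.
Qed.

(** Both sides satisfy the same first order recurrence in k, because
    2 (2k + 1) = -4 (n - k) when 2n + 1 = 0, and k + 1 is invertible as long as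
    k + 1 < p.  For n < k < p both sides vanish. *)
Lemma bin_central_mod (F : finFieldType) (n k : nat) :
  #|F| \in [pchar F] -> #|F| = n.*2.+1 -> (k < #|F|)%N ->
  'C(k.*2, k)%:R = 'C(n, k)%:R * (- 4) ^+ k :> F.
Proof.
move=> pF qE; elim: k => [|k IH] kp; first by rewrite !bin0 mulr1.
have k0 : k.+1%:R != 0 :> F.
  by rewrite -(dvdn_pcharf pF) gtnNdvd.
apply: (mulfI k0).
have := congr1 (fun m => m%:R : F) (bin_central_rec k) => /=.
have := congr1 (fun m => m%:R : F) (mul_bin_left n k) => /=.
rewrite 5!natrM (IH (ltnW kp)) => E1 ->; rewrite [RHS]mulrA E1 {E1}.
have [kn|nk] := leqP k n; last by rewrite bin_small // !(mul0r, mulr0).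
have n1 : n%:R + n%:R + 1 = 0 :> F by rewrite -natrD addnn natr1 -qE card_natr_eq0.
have -> : k.*2.+1%:R = k%:R + k%:R + 1 :> F by rewrite -natrD addnn natr1.
rewrite natrB // exprS.
set N := n%:R in n1 *; set K := k%:R; set C := 'C(n, k)%:R; set E := _ ^+ k.
have -> : K + K + 1 = K + K + 1 - (N + N + 1) by rewrite n1 subr0.
ring.
Qed.

(** * Quadratic character sums *)

Lemma monic_quadratic (R : nzRingType) (b c : R) :
  'X^2 + b%:P * 'X + c%:P \is monic /\ size ('X^2 + b%:P * 'X + c%:P) = 3%N.
Proof.
have sz : size ('X^2 + b%:P * 'X + c%:P) = 3%N.
  have -> : 'X^2 + b%:P * 'X + c%:P = ('X + b%:P) * 'X + c%:P by rewrite mulrDl expr2.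
  by rewrite size_MXaddC size_XaddC -size_poly_eq0 size_XaddC.
split=> //; rewrite monicE lead_coefE sz /=.
by rewrite !(coefD, coefXn, coefC, coefMX) /= !addr0.
Qed.

Lemma coef_monic_exp (R : idomainType) (f : {poly R}) (m k : nat) :
  f \is monic -> size f = m.+1 -> size (f ^+ k) = (m * k).+1 /\ (f ^+ k)`_(m * k) = 1.
Proof.
move=> fm sf; have fkm := monic_exp k fm.
have sz : size (f ^+ k) = (m * k).+1.
  by have := size_exp f k; rewrite sf /= => <-; rewrite prednK // lt0n size_poly_eq0 monic_neq0.
by split=> //; move: fkm; rewrite monicE lead_coefE sz => /eqP.
Qed.

Section CharacterSums.

Variables (F : finFieldType) (n : nat).
Hypotheses (pF : #|F| \in [pchar F]) (qE : #|F| = n.*2.+1).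

Lemma half_card_gt0 : (0 < n)%N.
Proof. by have := finNzRing_gt1 F; rewrite qE ltnS double_gt0. Qed.

Let n0 := half_card_gt0.

Lemma two_neq0 : 2 != 0 :> F.
Proof. by rewrite -(dvdn_pcharf pF) qE gtnNdvd // ltnS (leq_double 1). Qed.

Lemma expf_double (x : F) : x != 0 -> x ^+ n.*2 = 1.
Proof. by have := @expf_card_pred F x; rewrite qE. Qed.

Lemma expf_sqr (x : F) : x != 0 -> (x ^+ 2) ^+ n = 1.
Proof. by rewrite -exprM mul2n; exact: expf_double. Qed.

Lemma expf_sqrM (x z : F) : x != 0 -> (x ^+ 2 * z) ^+ n = z ^+ n.
Proof. by move=> x0; rewrite exprMn expf_sqr // mul1r. Qed.

Lemma sum_horner_half (f : {poly F}) : (size f <= n.*2.*2.+1)%N ->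
  \sum_x f.[x] = - (f`_(n.*2) + f`_(n.*2.*2)).
Proof. by have := @sum_horner F f; rewrite qE. Qed.

Lemma sum_indicator0 : \sum_(x : F) (x == 0)%:R = 1 :> F.
Proof. by rewrite (bigD1 0) //= eqxx big1 ?addr0 // => x /negbTE->. Qed.

Lemma eq0_expf (z : F) : (z == 0)%:R = 1 - z ^+ n.*2.
Proof.
case: eqVneq => [->|z0]; first by rewrite expr0n double_eq0 gtn_eqF // subr0.
by rewrite expf_double // subrr.
Qed.

(** The number of roots of x^2 - u x + c.  The indicator of z = 0 is
    1 - z^(2n); after completing the square the sum reads off the coefficient
    of X^(2n) in (X^2 - D/4)^(2n), which is
    'C(2n, n) (- D/4)^n = D^n for the discriminant D. *)
Lemma sum_quad_root (u c : F) :
  \sum_x (x ^+ 2 - u * x + c == 0)%:R = 1 + (u ^+ 2 - 4 * c) ^+ n :> F.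
Proof.
have h2 := two_neq0; set e := - ((u ^+ 2 - 4 * c) / 4).
have n4 : 4 != 0 :> F by rewrite (_ : 4 = 2 * 2) ?mulf_neq0 // -natrM.
transitivity (\sum_x (1 - ('X^2 + 0%:P * 'X + e%:P).[x] ^+ n.*2)).
  rewrite -(sum_scale _ (u / 2) (oner_neq0 F)); apply: eq_bigr => x _.
  rewrite eq0_expf !hornerE /=; congr (1 - _ ^+ _); rewrite /e; field.
  by rewrite n4.
under eq_bigr do rewrite -horner_exp.
rewrite sumrB sumr_const card_natr_eq0 sub0r.
have [qm qs] := monic_quadratic 0 e; have [sz lc] := coef_monic_exp n.*2 qm qs.
rewrite sum_horner_half ?sz ?mul2n // opprK -[n.*2.*2]mul2n lc addrC; congr (_ + _).
rewrite -/(trinomial_coef n.*2 0 e) trinomial_coef_double0 -mulr_natr (bin_central_mod pF qE); last first.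
  by rewrite qE ltnS -addnn leq_addl.
rewrite binn mul1r -exprMn /e; congr (_ ^+ _); field.
by rewrite n4.
Qed.

(** If u is not a square, then X^2 - u has no root, and its root count
    1 + (4 u)^n = 1 + u^n vanishes. *)
Lemma euler_criterion (u : F) : u != 0 ->
  u ^+ n = if [exists x, x ^+ 2 == u] then 1 else -1.
Proof.
move=> u0; case: ifP => [/existsP[x /eqP xu]|/negbT].
  by rewrite -xu expf_sqr //; apply: contraNneq u0 => x0; rewrite -xu x0 expr0n.
rewrite negb_exists => /forallP H.
have := sum_quad_root 0 (- u); rewrite big1 => [|x _]; last first.
  by rewrite mul0r subr0 subr_eq0 (negbTE (H x)).
rewrite expr0n sub0r mulrN opprK exprMn (_ : 4 = 2 ^+ 2) ?expf_sqr ?two_neq0 -?natrX //.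
by rewrite mul1r => /esym/eqP; rewrite addrC addr_eq0 => /eqP.
Qed.

Lemma sum_expr_quad (b c : F) : \sum_u ((u + b) * (u + c)) ^+ n = -1.
Proof.
have [qm qs] := monic_quadratic (b + c) (b * c); have [sz lc] := coef_monic_exp n qm qs.
transitivity (\sum_x (('X^2 + (b + c)%:P * 'X + (b * c)%:P) ^+ n).[x]).
  by apply: eq_bigr => x _; rewrite horner_exp !hornerE; congr (_ ^+ _); ring.
rewrite sum_horner_half ?sz; last by rewrite mul2n ltnS leq_double -addnn leq_addl.
rewrite -{1}mul2n lc nth_default ?addr0 // sz mul2n.
by rewrite ltn_double -addnn -{1}[n]addn0 ltn_add2l.
Qed.

(** Both sides count pairs (x, u) with x^2 - u x + c = 0, weighted by
    ((u + b) (u + b'))^n.  For x != 0 the only such u is x + c/x, and the weight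
    is the summand on the left, as x^(2n) = 1.  For x = 0 there is no u unless
    c = 0, when every u occurs and the weights add up to -1; in both cases this
    is the left summand c^(2n) minus 1. *)
Lemma sum_expr_quartic (b b' c : F) :
  \sum_x ((x ^+ 2 + b * x + c) * (x ^+ 2 + b' * x + c)) ^+ n =
  1 + \sum_u (1 + (u ^+ 2 - 4 * c) ^+ n) * ((u + b) * (u + b')) ^+ n.
Proof.
under [in RHS]eq_bigr do rewrite -sum_quad_root mulr_suml.
rewrite exchange_big /= -[X in _ = X + _]sum_indicator0 -big_split /=; apply: eq_bigr => x _.
have [->|x0] := eqVneq x 0.
  under eq_bigr do rewrite expr0n mulr0 subr0 add0r.
  rewrite -mulr_sumr sum_expr_quad expr0n !mulr0 !add0r mulrN1. rewrite eq0_expf.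
  by rewrite -expr2 -exprM mul2n opprB addrC subrK.
rewrite add0r (bigD1 (x + c / x)) //= big1 => [|u ux]; last first.
  case: eqP => [xu|]; last by rewrite mul0r.
  case/eqP: ux; apply: (mulIf x0); rewrite mulrDl divfK //.
  by apply/eqP; rewrite eq_sym -subr_eq0 -xu; apply/eqP; ring.
rewrite addr0 (_ : _ == 0); last by apply/eqP; field.
rewrite mul1r -[RHS](expf_sqrM _ x0); congr (_ ^+ _); field.
by rewrite x0.
Qed.

(** Substitute u = - b + 1/v and multiply by the square v^4.  The root u = - b
    goes to infinity, and the value v = 0, where the cubic is 1, is in
    excess. *)
Lemma sum_expr_quartic_cubic (b b' c : F) :
  \sum_u ((u ^+ 2 - 4 * c) * ((u + b) * (u + b'))) ^+ n =
  \sum_v ((1 - 2 * b * v + (b ^+ 2 - 4 * c) * v ^+ 2) * (1 + (b' - b) * v)) ^+ n - 1.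
Proof.
rewrite -(sum_scale _ (- b) (oner_neq0 F)) (reindex_inj invr_inj) /=.
rewrite -[X in _ = _ - X]sum_indicator0 -sumrB; apply: eq_bigr => v _.
have [->|v0] := eqVneq v 0.
  rewrite invr0 mulr0 add0r addNr mul0r mulr0 expr0n gtn_eqF //.
  by rewrite !(mulr0, expr0n) /= subr0 !addr0 mulr1 expr1n subrr.
rewrite subr0 -[LHS](expf_sqrM _ (expf_neq0 2 v0)); congr (_ ^+ _); field.
by rewrite v0.
Qed.

Lemma coef_quartic_exp (a b c d : F) : a != 0 -> d = b ^+ 2 - 4 * c ->
  ((('X^2 + b%:P * 'X + c%:P) * ('X^2 + (2 * a + b)%:P * 'X + c%:P)) ^+ n)`_(n.*2) =
  trinomial_coef n (- (4 * a * b + 2 * d)) (d * (4 * a ^+ 2 + 4 * a * b + d)).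
Proof.
move=> a0 dE; set b' := 2 * a + b.
set q1 := _ + c%:P; set q2 := _ + c%:P.
set e := - _; set d' := 4 * a ^+ 2 + _ + d.
have [m1 s1] := monic_quadratic b c; have [m2 s2] := monic_quadratic b' c.
have m12 : q1 * q2 \is monic by rewrite monicMl.
have s12 : size (q1 * q2) = 5%N by rewrite size_monicM ?monic_neq0 // s1 s2.
have [sz lc] := coef_monic_exp n m12 s12.
have n4 : (4 * n = n.*2.*2)%N by rewrite -!mul2n mulnA.
have E1 : \sum_x ((q1 * q2) ^+ n).[x] = - (((q1 * q2) ^+ n)`_(n.*2) + 1).
  by rewrite sum_horner_half ?sz ?n4 // -n4 lc.
set K := d *: 'X^2 + e%:P * 'X + d'%:P.
have E2 : \sum_w (w * (d * w ^+ 2 + e * w + d')) ^+ n = - trinomial_coef n e (d * d').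
  transitivity (\sum_w ('X^n * K ^+ n).[w]).
    by apply: eq_bigr => w _; rewrite hornerM !horner_exp !hornerE exprMn.
  (* 3n < 4n, so that the n-th power of the cubic has no term in degree 2(p - 1). *)
  have szK : (size ('X^n * K ^+ n)%R <= n.*2.*2)%N.
    have sK : (size K <= 3)%N.
      rewrite -[K]addrA (leq_trans (size_polyD _ _)) // geq_max.
      rewrite (leq_trans (size_scale_leq _ _)) ?size_polyXn //=.
      by rewrite size_MXaddC; case: ifP => // _; rewrite ltnS (leq_trans (size_polyC_leq1 _)).
    apply: (leq_trans (size_polyMleq _ _)); rewrite size_polyXn addSn /=.
    apply: (leq_trans (leq_add (leqnn n) (size_poly_exp_leq _ _))).
    have pK : ((size K).-1 <= 2)%N by rewrite -subn1 leq_subLR.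
    rewrite -n4 [(4 * n)%N]mulSn leq_add2l [(3 * n)%N]mulSn -addn1 addnC.
    by rewrite leq_add // leq_mul.
  rewrite sum_horner_half ?(leq_trans szK) // [X in _ + X]nth_default // addr0.
  by rewrite coefXnM -addnn ltnNge leq_addl addnK trinomial_coef_lead.
move: E1; rewrite (eq_bigr (fun x => ((x ^+ 2 + b * x + c) * (x ^+ 2 + b' * x + c)) ^+ n)).
  rewrite sum_expr_quartic (eq_bigr (fun u => ((u + b) * (u + b')) ^+ n +
     ((u ^+ 2 - 4 * c) * ((u + b) * (u + b'))) ^+ n)) => [|u _]; last first.
    by rewrite [(1 + _) * _]mulrDl mul1r [X in _ = _ + X]exprMn.
  rewrite big_split /= sum_expr_quad sum_expr_quartic_cubic -dE.
  (* The shift v = (w - 1) / (2a) moves the root - 1/(2a) of the cubic to 0. *)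
  have a2 : (2 * a)^-1 != 0 by rewrite invr_neq0 // mulf_neq0 // two_neq0.
  rewrite -(sum_scale _ (- (2 * a)^-1) a2) (eq_bigr (fun w => (w * (d * w ^+ 2 + e * w + d')) ^+ n)).
    rewrite E2 => E; apply: oppr_inj; move: E; set S := trinomial_coef _ _ _; set T := _`_ _ => E.
    have -> : - T = - (T + 1) + 1 by ring.
    by rewrite -E; ring.
  move=> w _; rewrite -[RHS](expf_sqrM _ a2); congr (_ ^+ _).
  by rewrite /e /d' /b'; field; rewrite two_neq0 a0.
by move=> x _; rewrite horner_exp !hornerE.
Qed.

End CharacterSums.

(** * The sum over a prime field *)

Section CentralSum.

Variables (F : finFieldType) (n : nat).
Hypotheses (pF : #|F| \in [pchar F]) (qE : #|F| = n.*2.+1).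

Lemma sum_bin_trinomial_coef (a b c : F) : a != 0 ->
  \sum_(k < n.+1) (-1) ^+ k * (trinomial_coef k.*2 (b + a) c / a ^+ k.*2) *+ 'C(n, k) =
  (-1) ^+ n *
  ((('X^2 + b%:P * 'X + c%:P) * ('X^2 + (2 * a + b)%:P * 'X + c%:P)) ^+ n)`_(n.*2).
Proof.
move=> a0; set r := 'X^2 + (b + a)%:P * 'X + c%:P.
have -> : ('X^2 + b%:P * 'X + c%:P) * ('X^2 + (2 * a + b)%:P * 'X + c%:P)
  = (-1) *: ((a ^+ 2) *: 'X^2 - r ^+ 2).
  by rewrite /r -!mul_polyC !(polyCD, polyCM, polyCN); ring.
rewrite exprZn coefZ signrMK exprDn coef_sum; apply: eq_bigr => k _.
have kn : (k <= n)%N by rewrite -ltnS.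
have a2k : a ^+ (n - k).*2 = (a ^+ k.*2)^-1.
  apply: (mulIf (expf_neq0 k.*2 a0)); rewrite mulVf ?expf_neq0 //.
  by rewrite -exprD doubleB subnK ?leq_double // (expf_double qE).
rewrite exprZn -!exprM !mul2n coefMn -scalerAl coefZ coefXnM.
rewrite ltn_double ltnNge leq_subr /= doubleB subKn ?leq_double //.
rewrite -doubleB a2k [(- r ^+ 2) ^+ k]exprNn -exprM mul2n -polyC1 -polyCN -rmorphXn coefCM -/(trinomial_coef k.*2 (b + a) c).
by congr (_ *+ _); rewrite [LHS]mulrA [LHS]mulrC.
Qed.

Lemma central_sum_mod (a b c d : F) : a != 0 -> d = b ^+ 2 - 4 * c ->
  let y := (2 * a * b + d) / (4 * a) in
  \sum_(k < #|F|) 'C(k.*2, k)%:R * (trinomial_coef k.*2 (b + a) c / (a ^+ k.*2 * 4 ^+ k)) =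
  (2 * a) ^+ n * trinomial_coef n y ((y ^+ 2 - c) / 4).
Proof.
move=> a0 dE y; have h2 := two_neq0 pF qE.
have n4 : 4 != 0 :> F by rewrite (_ : 4 = 2 * 2) ?mulf_neq0 // -natrM.
transitivity (\sum_(k < #|F|) (-1) ^+ k * (trinomial_coef k.*2 (b + a) c / a ^+ k.*2) *+ 'C(n, k)).
  apply: eq_bigr => k _; rewrite (bin_central_mod pF qE) // -[RHS]mulr_natl -[LHS]mulrA; congr (_ * _).
  by rewrite exprNn invfM; field; rewrite !expf_neq0.
have np : (n.+1 <= #|F|)%N by rewrite qE ltnS -addnn leq_addl.
(* 'C(n, k) vanishes for n < k < p. *)
transitivity (\sum_(k < n.+1) (-1) ^+ k * (trinomial_coef k.*2 (b + a) c / a ^+ k.*2) *+ 'C(n, k)).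
  rewrite [RHS](big_ord_widen _ (fun k => (-1) ^+ k * (trinomial_coef k.*2 (b + a) c / a ^+ k.*2) *+ 'C(n, k)) np).
  rewrite [RHS]big_mkcond; apply: eq_bigr => k _; case: ltnP => // nk.
  by rewrite bin_small // mulr0n.
rewrite sum_bin_trinomial_coef // (coef_quartic_exp pF qE a0 dE).
(* The factor (- 8 a)^n combines with (- 1)^n into (4 * (2 a))^n = (2 a)^n. *)
have -> : - (4 * a * b + 2 * d) = (- (8 * a)) * y by rewrite /y; field; rewrite a0 n4.
have -> : d * (4 * a ^+ 2 + 4 * a * b + d) = (- (8 * a)) ^+ 2 * ((y ^+ 2 - c) / 4).
  by rewrite /y dE; field; rewrite a0 n4.
rewrite trinomial_coefZ mulrA -exprMn; congr (_ * _).
by rewrite -[RHS](expf_sqrM qE _ h2); congr (_ ^+ _); ring.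
Qed.
End CentralSum.

(** * Legendre polynomials as central trinomial coefficients *)

(** The trinomial is (X + al) (s + (X + al)); expand the second factor in powers
    of X + al. *)
Lemma trinomial_coef_prod (R : comNzRingType) (n : nat) (al s : R) :
  trinomial_coef n (al *+ 2 + s) (al * (al + s)) =
  \sum_(k < n.+1) al ^+ k * s ^+ (n - k) *+ ('C(n, k) * 'C(n + k, k)).
Proof.
rewrite /trinomial_coef.
have -> : 'X^2 + (al *+ 2 + s)%:P * 'X + (al * (al + s))%:P
   = (1 *: 'X + al%:P) * (s%:P + (1 *: 'X + al%:P)).
  by rewrite scale1r !(polyCD, polyCM, polyCMn); ring.
rewrite exprMn [(s%:P + _) ^+ n]exprDn mulr_sumr coef_sum; apply: eq_bigr => k _.
rewrite mulrnAr coefMn mulrCA -exprD -rmorphXn coefCM coef_binomial ?leq_addr //.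
have -> : 'C(n + k, k) = 'C(n + k, n) by rewrite -bin_sub ?leq_addl // addnK.
by rewrite addKn expr1n mul1r mulrnAr -mulrnA mulnC [s ^+ _ * _]mulrC.
Qed.

Lemma coef_legendre_summand n (k : 'I_n.+1) :
  ((2^-1 *: ('X - 1)) ^+ k : {poly rat})`_n = (k == ord_max)%:R / 2 ^+ n.
Proof.
have -> : 2^-1 *: ('X - 1) = 2^-1 *: 'X + (- 2^-1)%:P :> {poly rat}.
  by rewrite scalerBr alg_polyC polyCN.
case: eqVneq => [->|kn].
  by rewrite coef_binomial //= subnn mulr1 binn mul1r exprVn.
rewrite mul0r nth_default // (leq_trans (size_poly_exp_leq _ _)) //.
have ltk : (k < n)%N by rewrite ltn_neqAle -ltnS ltn_ord andbT -val_eqE in kn *.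
apply: leq_ltn_trans ltk; rewrite -[leqRHS]mul1n leq_mul // -subn1 leq_subLR.
apply: (leq_trans (size_polyD _ _)); rewrite geq_max.
by rewrite (leq_trans (size_scale_leq _ _)) ?size_polyX // (leq_trans (size_polyC_leq1 _)).
Qed.

(** In the definition of P_n, k-th powers of (t - 1) / 2 at t = y/s become
    al^k s^(-k) with al = (y - s) / 2, so that for a square root s of c the
    left side is the sum of trinomial_coef_prod.  As 2 al + s = y and
    al (al + s) = (y^2 - s^2) / 4, only c = s^2 is left.  For c = 0 both
    sides reduce to the leading coefficient of P_n times y^n. *)
Lemma sqrt_legendre_trinomial_coef (n : nat) (y c : rat) :
  sqrt_legendre n y c = trinomial_coef n y ((y ^+ 2 - c) / 4).
Proof.
have [->|c0] := eqVneq c 0.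
  have -> : trinomial_coef n y ((y ^+ 2 - 0) / 4) = trinomial_coef n ((y / 2) *+ 2 + 0) (y / 2 * (y / 2 + 0)).
    by congr trinomial_coef; field.
  rewrite trinomial_coef_prod (bigD1 ord_max) //= big1 => [|k kn]; last first.
    have ltk : (k < n)%N by rewrite ltn_neqAle -ltnS ltn_ord andbT -val_eqE in kn *.
    by rewrite expr0n subn_eq0 leqNgt ltk mulr0 mul0rn.
  rewrite /sqrt_legendre (bigD1 ord_max) //= big1 => [|i ni]; last first.
    (* The exponent (n - i)./2 also vanishes for i = n - 1, but there the
       parity of P_n gives a zero coefficient. *)
    have [oni|eni] := boolP (odd (n + i)).
      by rewrite legendre_poly_parity // !mul0r.
    have lti : (i < n)%N by rewrite ltn_neqAle -ltnS ltn_ord andbT -val_eqE in ni *.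
    rewrite expr0n gtn_eqF ?mulr0 // half_gt0.
    rewrite ltn_subRL addn1 ltn_neqAle lti andbT; apply: contra eni => /eqP iE.
    by rewrite oddD -[in odd n]iE /= addNb addbb.
  rewrite /legendre_poly coef_sum (bigD1 ord_max) //= big1 => [|k kn]; last first.
    by rewrite coefZ coef_legendre_summand (negbTE kn) mul0r mulr0.
  rewrite coefZ (coef_legendre_summand ord_max) eqxx !subnn expr0 !addr0 !mulr1.
  by rewrite -[RHS]mulr_natl expr_div_n mulr1n; field; rewrite expf_neq0.
apply: (fmorph_inj (ratr : {rmorphism rat -> algC})).
have sc := sqrtCK (ratr c : algC); set s := sqrtC _ in sc.
have s0 : s != 0 by rewrite sqrtC_eq0 fmorph_eq0.
rewrite /= (sqrt_legendreE _ _ s0 sc) rmorph_trinomial_coef /=.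
set Y := ratr y; set al := (Y - s) / 2.
have -> : ratr ((y ^+ 2 - c) / 4) = al * (al + s).
  by rewrite fmorph_div rmorphB rmorphXn /= -sc -/Y rmorph_nat /al; field.
have YE : Y = al *+ 2 + s by rewrite /al; field.
rewrite [in RHS]YE trinomial_coef_prod /legendre_poly rmorph_sum horner_sum mulr_sumr.
apply: eq_bigr => k _; have kn : (k <= n)%N by rewrite -ltnS.
rewrite /= map_polyZ rmorphXn /= map_polyZ rmorphB rmorph1 /= map_polyX.
rewrite !(hornerZ, horner_exp) rmorph_nat fmorphV rmorph_nat !hornerE.
rewrite /= mulr_natr mulrnAl; congr (_ *+ _).
rewrite -{1}(subnK kn) exprD -mulrA -exprMn mulrC; congr (_ ^+ _ * _).
by rewrite /al; field; rewrite s0.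
Qed.

(** * Reduction of rational numbers modulo p *)

(** x has a fraction m / n with n invertible in F, and z is its image in F.
    Asking only for some fraction, not the reduced one, makes the relation
    visibly compatible with the field operations. *)
Definition reduces (F : fieldType) (x : rat) (z : F) : Prop :=
  exists m n : int, [/\ n%:~R != 0 :> F, x * n%:~R = m%:~R & z * n%:~R = m%:~R].

Section Reduction.
Variable F : fieldType.
Implicit Types (x y : rat) (z t : F).

Lemma reduces_int (m : int) : reduces m%:~R (m%:~R : F).
Proof. by exists m, 1; rewrite !mulr1 oner_neq0. Qed.

Lemma reduces_nat (m : nat) : reduces m%:R (m%:R : F).
Proof. exact: (reduces_int m). Qed.

Lemma reducesD x y z t : reduces x z -> reduces y t -> reduces (x + y) (z + t).
Proof.
move=> [m [n [n0 xE zE]]] [m' [n' [n0' yE tE]]].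
exists (m * n' + m' * n), (n * n').
by split; rewrite !(intrD, intrM) ?mulf_neq0 // -?xE -?zE -?yE -?tE; ring.
Qed.

Lemma reducesM x y z t : reduces x z -> reduces y t -> reduces (x * y) (z * t).
Proof.
move=> [m [n [n0 xE zE]]] [m' [n' [n0' yE tE]]].
exists (m * m'), (n * n').
by split; rewrite !intrM ?mulf_neq0 // -?xE -?zE -?yE -?tE; ring.
Qed.

Lemma reducesN x z : reduces x z -> reduces (- x) (- z).
Proof.
by move=> [m [n [n0 xE zE]]]; exists (- m), n; rewrite !mulNr xE zE !rmorphN.
Qed.

Lemma reducesV x z : z != 0 -> reduces x z -> reduces x^-1 z^-1.
Proof.
move=> z0 [m [n [n0 xE zE]]].
have mF : m%:~R != 0 :> F by rewrite -zE mulf_neq0.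
have m0 : m%:~R != 0 :> rat by apply: contraNneq mF => /eqP; rewrite intr_eq0 => /eqP->.
have x0 : x != 0 by apply: contraNneq m0 => x0; rewrite -xE x0 mul0r.
by exists n, m; rewrite mF -xE -zE !mulKf.
Qed.

Lemma reducesX k x z : reduces x z -> reduces (x ^+ k) (z ^+ k).
Proof.
by move=> r; elim: k => [|k IH]; rewrite ?exprS; [exact: (reduces_nat 1)|exact: reducesM].
Qed.

Lemma reduces_sum I (r : seq I) (P : pred I) (f : I -> rat) (g : I -> F) :
  (forall i, P i -> reduces (f i) (g i)) ->
  reduces (\sum_(i <- r | P i) f i) (\sum_(i <- r | P i) g i).
Proof.
move=> fg; apply: (big_ind2 (fun x z => reduces x z)) => //; first exact: (reduces_nat 0).
by move=> x z y t; exact: reducesD.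
Qed.

Lemma reduces_trinomial_coef k x y z t : reduces x z -> reduces y t ->
  reduces (trinomial_coef k x y) (trinomial_coef k z t).
Proof.
move=> rx ry; rewrite !trinomial_coefE; apply: reduces_sum => i _.
rewrite -mulr_natr -[X in reduces _ X]mulr_natr.
by apply: reducesM; [apply: reducesM; exact: reducesX|exact: reduces_nat].
Qed.

Variable p : nat.
Hypothesis pF : p \in [pchar F].

Lemma reduces_denq x z : reduces x z -> coprimez p (denq x).
Proof.
move=> [m [n [n0 xE _]]]; rewrite /coprimez.
change (coprime p `|denq x|); rewrite prime_coprime ?(pcharf_prime pF) //.
change (~~ (p %| denq x)%Z).
have dn : (denq x %| n)%Z.
  have cop : coprimez (denq x) (numq x) by rewrite /coprimez gcdzC; exact: coprime_num_den.
  rewrite -(Gauss_dvdzr _ cop); apply/dvdzP; exists m.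
  apply: (@intr_inj rat); rewrite !intrM -xE mulrAC -{2}[x]divq_num_den divfK //.
  by rewrite intr_eq0 denq_neq0.
by apply: contraNN n0 => pd; rewrite -(dvdz_pcharf pF) (dvdz_trans pd).
Qed.

Lemma reduces0_numq x : reduces x (0 : F) -> (p %| numq x)%Z.
Proof.
move=> [m [n [n0 xE]]]; rewrite mul0r => /esym/eqP; rewrite -(dvdz_pcharf pF) => pm.
have E : numq x * n = m * denq x.
  apply: (@intr_inj rat); rewrite !intrM -xE mulrAC -{2}[x]divq_num_den divfK //.
  by rewrite intr_eq0 denq_neq0.
have : (p %| numq x * n)%Z by rewrite E dvdz_mulr.
rewrite -(dvdz_pcharf pF) in n0.
by rewrite Gauss_dvdzl // /coprimez; change (coprime p `|n|); rewrite prime_coprime ?(pcharf_prime pF).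
Qed.

Lemma rat_eqmod_reduces x y z : reduces x z -> reduces y z -> rat_eqmod p x y.
Proof.
move=> rx ry; split; [exact: reduces_denq rx|exact: reduces_denq ry|].
by apply: reduces0_numq; rewrite -(subrr z); apply: reducesD => //; exact: reducesN.
Qed.

End Reduction.

Lemma central_trinomial_reduces (F : fieldType) (k : nat) (b c : int) :
  reduces (central_trinomial k b c)%:~R (trinomial_coef k b%:~R c%:~R : F).
Proof.
rewrite -(rmorph_trinomial_coef (intmul 1 : {rmorphism int -> F})); exact: reduces_int.
Qed.

(** * The congruence *)

Lemma legendre_symbol_Fp (p n : nat) (a : int) : prime p -> p = n.*2.+1 ->
  (legendre_symbol a p)%:~R = a%:~R ^+ n :> 'F_p.
Proof.
move=> pp pE; have pF := pchar_Fp pp; have cF := card_Fp pp.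
rewrite /legendre_symbol (dvdz_pcharf pF).
have n0 : (0 < n)%N by have := prime_gt1 pp; rewrite pE ltnS double_gt0.
have [->|a0] := eqVneq; first by rewrite expr0n gtn_eqF.
rewrite (@euler_criterion _ n) ?cF //.
suff -> : [exists x : 'I_p, (x%:Z ^+ 2 == a %[mod p])%Z] = [exists x : 'F_p, x ^+ 2 == a%:~R].
  by case: ifP => _; rewrite ?rmorphN.
have sqE (m : nat) : (m%:Z ^+ 2 == a %[mod p])%Z = (m%:R ^+ 2 == a%:~R :> 'F_p).
  by rewrite eqz_mod_dvd (dvdz_pcharf pF) rmorphB rmorphXn subr_eq0.
apply/existsP/existsP => [[x] | [x xa]]; first by rewrite sqE; exists x%:R.
have xp : (x < p)%N by rewrite -[X in (_ < X)%N](Fp_cast pp).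
by exists (Ordinal xp); rewrite sqE /= natr_Zp.
Qed.

Theorem theorem5p6 (p : nat) (a b c d : int)
    (hp : prime p) (hp3 : (3 < p)%N)
    (hd : d = b ^+ 2 - 4 * c)
    (ha : ~~ (p %| a)%Z) :
  rat_eqmod p
    (\sum_(k < p)
       'C(2 * k, k)%:R *
       ((central_trinomial (2 * k)%N (b + a) c)%:~R
          / (a%:~R ^+ (2 * k)%N * 4 ^+ k)))
    ((legendre_symbol (2 * a) p)%:~R *
       sqrt_legendre ((p - 1) %/ 2)%N
         ((2 * a * b + d)%:~R / (4 * a)%:~R) c%:~R).
Proof.
have pF := pchar_Fp hp; have cF := card_Fp hp.
set n := ((p - 1) %/ 2)%N.
have pE : p = n.*2.+1.
  have podd : odd p by case: (even_prime hp) hp3 => // ->.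
  rewrite /n divn2 subn1 halfK; case: (p) podd => //= m /negbTE->.
  by rewrite subn0.
have pF' : #|'F_p| \in [pchar 'F_p] by rewrite cF.
have qE : #|'F_p| = n.*2.+1 by rewrite cF.
have a0 : a%:~R != 0 :> 'F_p by rewrite -(dvdz_pcharf pF).
have h2 := two_neq0 pF' qE.
have h4 : 4 != 0 :> 'F_p by rewrite (_ : 4 = 2 * 2) ?mulf_neq0 // -natrM.
have dE : d%:~R = b%:~R ^+ 2 - 4 * c%:~R :> 'F_p.
  by rewrite hd rmorphB rmorphXn rmorphM.
have := central_sum_mod pF' qE a0 dE; set y := _ / _ => /= sumE.
have ry : reduces ((2 * a * b + d)%:~R / (4 * a)%:~R) y.
  have -> : y = (2 * a * b + d)%:~R / (4 * a)%:~R by rewrite /y !(intrD, intrM).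
  apply: reducesM; first exact: reduces_int.
  by apply: reducesV; [rewrite intrM mulf_neq0|exact: reduces_int].
apply: (rat_eqmod_reduces pF (z := (2 * a%:~R) ^+ n * trinomial_coef n y ((y ^+ 2 - c%:~R) / 4))).
  rewrite -sumE cF; apply: reduces_sum => k _.
  rewrite mul2n; apply: reducesM; first exact: reduces_nat.
  rewrite -intrD; apply: reducesM; first exact: central_trinomial_reduces.
  apply: reducesV; first by rewrite mulf_neq0 ?expf_neq0.
  by apply: reducesM; apply: reducesX; [exact: reduces_int|exact: reduces_nat].
rewrite sqrt_legendre_trinomial_coef; apply: reducesM.
  by have := reduces_int 'F_p (legendre_symbol (2 * a) p); rewrite (legendre_symbol_Fp _ hp pE) intrM.
apply: reduces_trinomial_coef => //; apply: reducesM; last by apply: reducesV => //; exact: reduces_nat.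
by apply: reducesD; [exact: reducesX|apply: reducesN; exact: reduces_int].
Qed.
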